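(* Let $A,B$ be positive definite matrices. Then \[ A\,\widehat{sp}_{-1}\,B\prec_{\log}AB^{-1}A. \]
   Context: For positive definite matrices $A,B$ and $t\in\mathbb{R}$: $A\sharp B:=A^{1/2}(A^{-1/2}BA^{-1/2})^{1/2}A^{1/2}$ and $A\,\widehat{sp}_t\,B:=(A^{-1}\sharp B)^tA(A^{-1}\sharp B)^t$; so $A\,\widehat{sp}_{-1}\,B=(A^{-1}\sharp B)^{-1}A(A^{-1}\sharp B)^{-1}$. For $n\times n$ positive semidefinite matrices $X,Y$ with eigenvalues $\lambda_1(\cdot)\ge\dots\ge\lambda_n(\cdot)$, $X\prec_{\log}Y$ means $\prod_{j=1}^k\lambda_j(X)\le\prod_{j=1}^k\lambda_j(Y)$ for $k=1,\dots,n-1$ and $\det X=\det Y$. *)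

(* Defs.v *)
(* Matrices over an arbitrary numClosedFieldType C
   (e.g. the complex numbers), with its conjugation Num.conj and its
   (partial) order, under which "0 < z" means z is a positive real. *)
From HB Require Import structures.
From mathcomp Require Import all_boot all_order all_algebra.
From Stdlib Require Import ClassicalEpsilon.
Set Implicit Arguments.
Unset Strict Implicit.
Unset Printing Implicit Defensive.
Import Order.TTheory GRing.Theory Num.Theory.
Local Open Scope ring_scope.

Section Defs.
Variable C : numClosedFieldType.
Variable n : nat.

Definition adjmx (m p : nat) (M : 'M[C]_(m, p)) : 'M[C]_(p, m) :=
  map_mx Num.conj M^T.

Definition hermitian (A : 'M[C]_n) : Prop := adjmx A = A.

Definition psd (A : 'M[C]_n) : Prop :=
  hermitian A /\ forall x : 'cV[C]_n, 0 <= (adjmx x *m A *m x) 0 0.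

Definition posdef (A : 'M[C]_n) : Prop :=
  hermitian A /\ forall x : 'cV[C]_n, x != 0 -> 0 < (adjmx x *m A *m x) 0 0.

(* A^{1/2}: the (unique) positive semidefinite square root of a positive
   semidefinite matrix A (chosen by Hilbert's epsilon; 0 if none exists). *)
Definition sqrtmx (A : 'M[C]_n) : 'M[C]_n :=
  epsilon (inhabits 0) (fun S : 'M[C]_n => psd S /\ S *m S = A).

Definition gmean (A B : 'M[C]_n) : 'M[C]_n :=
  let Ah := sqrtmx A in
  let Aih := invmx Ah in
  Ah *m sqrtmx (Aih *m B *m Aih) *m Ah.

Definition sp_hat_m1 (A B : 'M[C]_n) : 'M[C]_n :=
  let G := invmx (gmean (invmx A) B) in G *m A *m G.

(* eigenvalues lambda_1 >= ... >= lambda_n (with multiplicity): a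
   non-increasingly sorted sequence of the roots of the characteristic
   polynomial (well defined for matrices with real spectrum, e.g. psd ones). *)
Definition eigvals (A : 'M[C]_n) : seq C :=
  epsilon (inhabits [::]) (fun s : seq C =>
    sorted (fun x y => y <= x) s /\
    char_poly A = \prod_(x <- s) ('X - x%:P)).

Definition eigval (A : 'M[C]_n) (j : nat) : C := nth 0 (eigvals A) j.-1.

Definition log_majorized (X Y : 'M[C]_n) : Prop :=
  (forall k : nat, (1 <= k <= n.-1)%N ->
     \prod_(1 <= j < k.+1) eigval X j <= \prod_(1 <= j < k.+1) eigval Y j)
  /\ \det X = \det Y.

End Defs.

(* Main.v *)
(**
Put [H = (A^-1 # B)^-1] and let [K] be the square root of [A], so that
[B^-1 = H A^-1 H].  Then [X = H A H] equals [S^* S] with [S = K H], and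
[Y = A B^-1 A] equals [T T^*] with [T = K^2 H K^-1].  Moreover
[T S = K^2 H^2 = H^-1 X H], so [T S] has the same eigenvalues as [X], and the
inequalities of Weyl and Horn bound the product [p] of the [k] largest ones by
the product of the [k] largest singular values of [T] and [S].  With [q] the
product of the [k] largest eigenvalues of [Y], this says [p ^ 2 <= q * p].

Concretely, if the columns of [W] span the eigenspace of [T S] for the [k]
largest eigenvalues, the Cauchy-Schwarz inequality for minors (from the
Cauchy-Binet formula) gives
[p ^ 2 * det (W^* W) ^ 2 <= det (W^* Y W) * det (W^* X W)], and Cauchy-Binet in
an eigenbasis bounds the right-hand side by [q * p * det (W^* W) ^ 2].
*)
From mathcomp Require Import all_boot all_order all_algebra.
From mathcomp Require Import all_fingroup spectral sesquilinear.
Require Import Defs.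
From Stdlib Require Import ClassicalEpsilon.
Set Implicit Arguments.
Unset Strict Implicit.
Unset Printing Implicit Defensive.
Import Order.TTheory GRing.Theory Num.Theory.
Local Open Scope ring_scope.

(** * Minors of products and the Cauchy-Schwarz inequality *)

Lemma det_mulmx_ffun (R : comNzRingType) (k n : nat)
    (P : 'M[R]_(k, n)) (Q : 'M[R]_(n, k)) :
  \det (P *m Q) =
    \sum_(f : {ffun 'I_k -> 'I_n}) (\prod_i P i (f i)) * \det (rowsub f Q).
Proof.
under [RHS]eq_bigr => f _ do rewrite /determinant big_distrr /=.
rewrite exchange_big; apply: eq_bigr => /= s _.
under eq_bigr => i _ do rewrite mxE.
rewrite (bigA_distr_bigA (fun i j => P i j * Q j (s i))) /= big_distrr /=.
apply: eq_bigr => f _; rewrite mulrCA big_split /=; congr (_ * (_ * _)).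
by apply: eq_bigr => i _; rewrite mxE.
Qed.

(* Summing over all maps instead of increasing ones counts each minor [k!]
   times and adds only vanishing terms. *)
Lemma Cauchy_Binet (R : comNzRingType) (k n : nat)
    (P : 'M[R]_(k, n)) (Q : 'M[R]_(n, k)) :
  k`!%:R * \det (P *m Q) =
    \sum_(f : {ffun 'I_k -> 'I_n}) \det (colsub f P) * \det (rowsub f Q).
Proof.
under [RHS]eq_bigr => f _ do rewrite {1}/determinant big_distrl /=.
rewrite exchange_big /=.
(* Every permutation [s] from the expansion of the minor of [P] contributes the same: reindexing by
   [h] undoes [s] in [P] and permutes the rows of [Q], whose sign cancels that of [s]. *)
rewrite (eq_bigr (fun=> \det (P *m Q))) => [|s _].
  by rewrite sumr_const card_Sn mulr_natl.
rewrite det_mulmx_ffun.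
pose h (f : {ffun 'I_k -> 'I_n}) := [ffun i => f ((s^-1)%g i)].
have h_inj : injective h.
  move=> f g /ffunP e; apply/ffunP => i.
  by have := e (s i); rewrite !ffunE permK.
rewrite (reindex_inj h_inj); apply: eq_bigr => f _ /=.
have -> : rowsub (h f) Q = row_perm s^-1 (rowsub f Q).
  by apply/matrixP => i j; rewrite !mxE ffunE.
rewrite row_permE det_mulmx det_perm odd_permV.
rewrite mulrA mulrAC (mulrC _ (_ ^+ s)) !mulrA -signr_addb addbb mul1r mulrC.
rewrite mulrC; congr (_ * _); apply: eq_bigr => i _.
by rewrite !mxE ffunE permK.
Qed.

Lemma sum_CauchySchwarz (C : numClosedFieldType) (I : finType) (a b : I -> C) :
  `|\sum_i a i * b i| ^+ 2 <= (\sum_i `|a i| ^+ 2) * (\sum_i `|b i| ^+ 2).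
Proof.
pose u : 'rV[C]_#|I| := \row_i a (enum_val i).
(* [dotmx] conjugates its second argument, so [b] enters conjugated. *)
pose v : 'rV[C]_#|I| := \row_i (b (enum_val i))^*.
have [+ _] := CauchySchwarz (@dotmx C #|I|) u v.
rewrite /= !dotmxE !mxE.
by congr (`|_| ^+ 2 <= _ * _);
  rewrite [RHS](reindex _ (onW_bij _ (enum_val_bij I)));
  apply: eq_bigr => i _ /=; rewrite !mxE ?conjCK ?normCK // mulrC.
Qed.

(** * Adjoints and Gram determinants *)

Section Adjoint.
Variable C : numClosedFieldType.

Lemma adjmxK (m p : nat) (M : 'M[C]_(m, p)) : adjmx (adjmx M) = M.
Proof. exact: trmxCK. Qed.

Lemma adjmxM (m p q : nat) (M : 'M[C]_(m, p)) (N : 'M[C]_(p, q)) :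
  adjmx (M *m N) = adjmx N *m adjmx M.
Proof. by rewrite /adjmx trmx_mul map_mxM. Qed.

Lemma adjmx_inv (n : nat) (M : 'M[C]_n) : adjmx (invmx M) = invmx (adjmx M).
Proof. by rewrite /adjmx trmx_inv map_invmx. Qed.

Lemma det_adjmx (n : nat) (M : 'M[C]_n) : \det (adjmx M) = (\det M)^*.
Proof. by rewrite /adjmx det_map_mx det_tr. Qed.

Lemma colsub_adjmx (m p q : nat) (f : 'I_q -> 'I_m) (M : 'M[C]_(m, p)) :
  colsub f (adjmx M) = adjmx (rowsub f M).
Proof. by apply/matrixP => i j; rewrite !mxE. Qed.

Lemma adjmx_diag (n : nat) (d : 'rV[C]_n) :
  adjmx (diag_mx d) = diag_mx (map_mx Num.conj d).
Proof. by rewrite /adjmx tr_diag_mx map_diag_mx. Qed.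

Lemma det_gram (n k : nat) (W : 'M[C]_(n, k)) :
  k`!%:R * \det (adjmx W *m W) =
    \sum_(f : {ffun 'I_k -> 'I_n}) `|\det (rowsub f W)| ^+ 2.
Proof.
rewrite Cauchy_Binet; apply: eq_bigr => f _.
by rewrite colsub_adjmx det_adjmx normCK mulrC.
Qed.

Lemma det_gram_ge0 (n k : nat) (W : 'M[C]_(n, k)) : 0 <= \det (adjmx W *m W).
Proof.
rewrite -(@pmulr_rge0 _ k`!%:R) ?ltr0n ?fact_gt0 // det_gram.
by apply: sumr_ge0 => f _; rewrite exprn_ge0.
Qed.

(** By Cauchy-Binet, the three determinants are, up to the factor [k!], the inner product and the
    squared norms of the vectors of minors of [P] and [Q]. *)
Lemma det_CauchySchwarz (n k : nat) (P Q : 'M[C]_(n, k)) :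
  `|\det (adjmx P *m Q)| ^+ 2 <=
    \det (adjmx P *m P) * \det (adjmx Q *m Q).
Proof.
have k0 : 0 < k`!%:R :> C by rewrite ltr0n fact_gt0.
rewrite -(ler_pM2l (mulr_gt0 k0 k0)) [leRHS]mulrACA !det_gram.
rewrite -expr2 -[X in X ^+ 2 * _](ger0_norm (ltW k0)) -exprMn -normrM.
rewrite Cauchy_Binet.
apply: (le_trans (sum_CauchySchwarz _ _)).
rewrite le_eqVlt; apply/orP; left; apply/eqP.
congr (_ * _); apply: eq_bigr => f _.
by rewrite colsub_adjmx det_adjmx norm_conjC.
Qed.

End Adjoint.

(** The image of [f] and the initial segment have equally many indices. Outside their intersection,
    each factor on the left is at most [mu], the last factor on the right, and each factor on the
    right is at least [mu]. *)
Lemma prod_nonincreasing_inj_le (R : numDomainType) (k n : nat) (d : nat -> R)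
    (f : {ffun 'I_k -> 'I_n}) :
    (forall i : 'I_n, 0 <= d i) ->
    (forall i j : 'I_n, (i <= j)%N -> d j <= d i) ->
    injective f ->
  \prod_(i < k) d (f i) <= \prod_(i < k) d i.
Proof.
move=> d0 d_dec f_inj.
case: k f f_inj => [|k] f f_inj; first by rewrite !big_ord0.
have le_kn : (k < n)%N.
  by rewrite -[k.+1]card_ord -[n]card_ord; apply: leq_card f_inj.
pose mu := d k; pose T := [set i : 'I_n | (i <= k)%N]; pose S := f @: setT.
have -> : \prod_(i < k.+1) d (f i) = \prod_(i in S) d i.
  rewrite big_imset /= => [|i j _ _]; last exact: f_inj.
  by apply: eq_bigl => i; rewrite inE.
pose w := widen_ord le_kn.
have w_inj : injective w by move=> i j /(congr1 val)/= e; apply: val_inj.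
have TE : T = w @: setT.
  apply/setP => i; rewrite inE; apply/idP/imsetP => [ik|[j _ ->] /=]; last first.
    by rewrite -ltnS.
  by exists (Ordinal (ik : (i < k.+1)%N)) => //; apply: val_inj.
have -> : \prod_(i < k.+1) d i = \prod_(i in T) d i.
  rewrite TE big_imset /= => [|i j _ _]; last exact: w_inj.
  by apply: eq_big => i; rewrite ?inE.
have cST : #|S| = #|T| by rewrite TE !card_imset.
have cD : #|S :\: T| = #|T :\: S|.
  by apply/eqP; rewrite -(eqn_add2l #|S :&: T|) cardsID setIC cardsID cST.
rewrite (big_setID T) [leRHS](big_setID S) /= setIC.
apply: ler_wpM2l; first by apply: prodr_ge0.
apply: (@le_trans _ _ (mu ^+ #|S :\: T|)).
  rewrite -prodr_const; apply: ler_prod => i; rewrite !inE -ltnNge => /andP[ki _].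
  by rewrite d0 (d_dec (Ordinal le_kn) i) //= ltnW.
rewrite cD -prodr_const; apply: ler_prod => i; rewrite !inE => /andP[_ ik].
by rewrite (d0 (Ordinal le_kn)) (d_dec i (Ordinal le_kn)).
Qed.

(** * Eigenvalues of Hermitian matrices *)

Section Spectrum.
Variables (C : numClosedFieldType) (n : nat).
Implicit Types (M U : 'M[C]_n) (d : 'rV[C]_n).

Lemma char_poly_conj (U V D : 'M[C]_n) :
  U *m V = 1%:M -> char_poly (V *m D *m U) = char_poly D.
Proof.
move=> UV1; have VU1 := mulmx1C UV1.
rewrite /char_poly; have -> : char_poly_mx (V *m D *m U) =
    map_mx polyC V *m char_poly_mx D *m map_mx polyC U.
  rewrite /char_poly_mx mulmxBr mulmxBl !map_mxM; congr (_ - _).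
  by rewrite mul_mx_scalar -scalemxAl -map_mxM VU1 map_mx1 scalemx1.
rewrite !det_mulmx mulrAC -det_mulmx -map_mxM VU1 map_mx1 det1.
exact: mul1r.
Qed.

Lemma hermitian_diagonalization M : hermitian M ->
  exists U d, [/\ U *m adjmx U = 1%:M, M = adjmx U *m diag_mx d *m U
                & forall i, d 0 i \is Num.real].
Proof.
move=> hM; have Mh : M \is hermsymmx.
  by apply/is_hermitianmxP; rewrite expr0 scale1r -[LHS]hM.
have Uu := spectral_unitarymx M.
exists (spectralmx M), (spectral_diag M); split.
- exact/unitarymxP.
- rewrite [in LHS](orthomx_spectralP (hermitian_normalmx Mh)).
  by rewrite invmx_unitary.
- by move=> i; apply: (mxOverP (hermitian_spectral_diag_real Mh)).
Qed.

Lemma eigvalsP M : hermitian M ->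
  sorted (fun x y => y <= x) (eigvals M) /\
  char_poly M = \prod_(x <- eigvals M) ('X - x%:P).
Proof.
move=> /hermitian_diagonalization[U [d [UU -> dR]]].
apply: (epsilon_spec (inhabits [::]) (fun s : seq C =>
  sorted (fun x y => y <= x) s /\ char_poly _ = \prod_(x <- s) ('X - x%:P))).
exists (sort (fun x y => y <= x) [seq d 0 i | i <- enum 'I_n]); split.
  (* The order on [C] is only partial; the entries can be sorted because they are real. *)
  apply: (@sort_sorted_in _ Num.real); last
    by apply/allP => _ /mapP[i _ ->]; apply: dR.
  by move=> x y xR yR; rewrite orbC real_leVge.
rewrite char_poly_conj // char_poly_trig; last first.
  by apply/is_trig_mxP => i j ij; rewrite mxE -val_eqE /= ltn_eqF.
rewrite (perm_big _ (permEl (perm_sort _ _))) /= big_map big_enum /=.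
by apply: eq_bigr => i _; rewrite mxE eqxx mulr1n.
Qed.

(** By unique factorization of the characteristic polynomial, [eigvals M] permutes the diagonal of
    any diagonalization; permuting the rows of [U] puts it in order. *)
Lemma sorted_diagonalization M : hermitian M ->
  exists2 U : 'M[C]_n, U *m adjmx U = 1%:M &
    M = adjmx U *m diag_mx (\row_i (eigvals M)`_i) *m U.
Proof.
move=> hM; have [_] := eigvalsP hM.
have [U [d [UU ME _]]] := hermitian_diagonalization hM.
rewrite [in LHS]ME char_poly_conj // char_poly_trig; last first.
  by apply/is_trig_mxP => i j ij; rewrite mxE -val_eqE /= ltn_eqF.
pose t := [tuple d 0 i | i < n].
have -> : \prod_(i < n) ('X - (diag_mx d i i)%:P) = \prod_(x <- t) ('X - x%:P).
  rewrite big_map big_enum /=.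
  by apply: eq_bigr => i _; rewrite mxE eqxx mulr1n.
move/prod_XsubC_eq; rewrite perm_sym => /tuple_permP[p eE].
exists (row_perm p U).
  apply/matrixP => i j; move/matrixP/(_ (p i) (p j)): UU.
  rewrite !mxE (inj_eq perm_inj) => <-.
  by apply: eq_bigr => l _; rewrite !mxE.
apply/matrixP => i j; rewrite [in LHS]ME !mxE (reindex_perm p) /=.
apply: eq_bigr => l _; rewrite !mul_mx_diag !mxE eE.
by rewrite (nth_mktuple (fun i => tnth t (p i)) 0 l) tnth_mktuple.
Qed.

Lemma size_eigvals M : hermitian M -> size (eigvals M) = n.
Proof.
case/eigvalsP => _ /(congr1 (fun p : {poly C} => size p)).
by rewrite size_char_poly size_prod_XsubC => -[].
Qed.

Lemma eigvals_nonincreasing M (i j : 'I_n) : hermitian M ->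
  (i <= j)%N -> (eigvals M)`_j <= (eigvals M)`_i.
Proof.
move=> hM ij; have [s_M _] := eigvalsP hM.
apply: (sorted_leq_nth (leT := fun x y => y <= x)) => //.
- by move=> x y z /= yx zx; apply: le_trans yx.
- by rewrite inE size_eigvals.
- by rewrite inE size_eigvals.
Qed.

(** Carries positivity of the quadratic form over to the eigenvalues; the vector is the unit
    eigenvector given by row [i] of [U]. *)
Lemma eigvals_quad M : hermitian M -> forall i : 'I_n,
  exists2 x : 'cV[C]_n, x != 0 & (eigvals M)`_i = (adjmx x *m M *m x) 0 0.
Proof.
move=> hM i; have [U UU ME] := sorted_diagonalization hM.
have row1 : row i U *m adjmx (row i U) = 1%:M.
  apply/matrixP => a b; rewrite !ord1; move/matrixP/(_ i i): UU.
  by rewrite !mxE !eqxx => <-; apply: eq_bigr => l _; rewrite !mxE.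
exists (adjmx (row i U)).
  by apply/eqP => x0; move/eqP: row1; rewrite x0 mulmx0 eq_sym oner_eq0.
rewrite adjmxK.
have : U *m M *m adjmx U = diag_mx (\row_i (eigvals M)`_i).
  by rewrite [in LHS]ME !mulmxA UU mul1mx -mulmxA UU mulmx1.
move/matrixP/(_ i i); rewrite !mxE eqxx mulr1n => <-.
apply: eq_bigr => l _; rewrite -row_mul; congr (_ * _); last by rewrite !mxE.
by rewrite [RHS]mxE.
Qed.

Lemma psd_eigvals_ge0 M : psd M -> forall i : 'I_n, 0 <= (eigvals M)`_i.
Proof. by case=> hM pM i; have [x _ ->] := eigvals_quad hM i. Qed.

Lemma posdef_eigvals_gt0 M : posdef M -> forall i : 'I_n, 0 < (eigvals M)`_i.
Proof. by case=> hM pM i; have [x x0 ->] := eigvals_quad hM i; apply: pM. Qed.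

Lemma posdef_psd M : posdef M -> psd M.
Proof.
case=> hM pM; split=> // x; have [->|x0] := eqVneq x 0.
  by rewrite mulmx0 mxE.
exact/ltW/pM.
Qed.

(** In an eigenbasis, Cauchy-Binet weights each squared minor by the product of the eigenvalues that
    [f] selects, which for injective [f] is at most the product of the [k] largest. *)
Lemma det_compression_le (k : nat) M (W : 'M[C]_(n, k)) : psd M ->
  \det (adjmx W *m M *m W) <=
    (\prod_(i < k) (eigvals M)`_i) * \det (adjmx W *m W).
Proof.
move=> pM; have [hM _] := pM; have [U UU ME] := sorted_diagonalization hM.
pose d := (\row_i (eigvals M)`_i : 'rV[C]_n).
pose Q := U *m W.
have -> : adjmx W *m W = adjmx Q *m Q.
  by rewrite adjmxM !mulmxA -[_ *m _ *m U]mulmxA (mulmx1C UU) mulmx1.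
have -> : adjmx W *m M *m W = adjmx Q *m (diag_mx d *m Q).
  by rewrite [in LHS]ME adjmxM !mulmxA.
have k0 : 0 < k`!%:R :> C by rewrite ltr0n fact_gt0.
rewrite -(ler_pM2l k0) mulrCA det_gram Cauchy_Binet mulr_sumr.
apply: ler_sum => f _.
have -> : rowsub f (diag_mx d *m Q) = diag_mx (\row_i d 0 (f i)) *m rowsub f Q.
  by rewrite !mul_diag_mx; apply/matrixP => i j; rewrite !mxE.
rewrite det_mulmx det_diag mulrCA colsub_adjmx det_adjmx [_^* * _]mulrC -normCK.
have [/injectiveP f_inj|/injectivePn[i [j ij fij]]] := boolP (injectiveb f).
  apply: ler_wpM2r; first exact: exprn_ge0.
  under eq_bigr => i _ do rewrite !mxE.
  apply: (@prod_nonincreasing_inj_le _ _ _ (fun i => (eigvals M)`_i)) => //.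
    exact: psd_eigvals_ge0.
  by move=> a b; apply: eigvals_nonincreasing.
(* A repeated index gives two equal rows, so the minor vanishes. *)
rewrite (determinant_alternate ij) ?normr0 ?expr0n ?mulr0 // => l.
by rewrite !mxE fij.
Qed.

End Spectrum.

(** * Positive definite matrices and the inequality for products of eigenvalues *)

Lemma invmx_mul (R : comUnitRingType) (n : nat) (M N : 'M[R]_n) :
  M \in unitmx -> N \in unitmx -> invmx (M *m N) = invmx N *m invmx M.
Proof.
move=> uM uN; have uMN : M *m N \in unitmx by rewrite unitmx_mul uM.
by rewrite -[RHS](mulmxK uMN) !mulmxA mulmxKV // mulVmx // mul1mx.
Qed.

Section PositiveMatrices.
Variables (C : numClosedFieldType) (n : nat).
Implicit Types (M P H K : 'M[C]_n).

Lemma psd_gram P : psd (adjmx P *m P).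
Proof.
split=> [|x]; first by rewrite /hermitian adjmxM adjmxK.
have -> : adjmx x *m (adjmx P *m P) *m x = adjmx (P *m x) *m (P *m x).
  by rewrite adjmxM !mulmxA.
by rewrite mxE; apply: sumr_ge0 => i _; rewrite !mxE mulrC mul_conjC_ge0.
Qed.

Lemma posdef1 : posdef (1%:M : 'M[C]_n).
Proof.
split=> [|x /cV0Pn[i xi]]; first by rewrite /hermitian /adjmx trmx1 map_mx1.
rewrite mulmx1 mxE (bigD1 i) //= ltr_wpDr ?sumr_ge0 //.
  by move=> j _; rewrite !mxE mulrC mul_conjC_ge0.
by rewrite !mxE mulrC mul_conjC_gt0.
Qed.

Lemma posdef_congr M P : P \in unitmx -> posdef M -> posdef (adjmx P *m M *m P).
Proof.
move=> uP [hM pM]; split=> [|x x0].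
  by rewrite /hermitian !adjmxM adjmxK hM mulmxA.
have -> : adjmx x *m (adjmx P *m M *m P) *m x = adjmx (P *m x) *m M *m (P *m x).
  by rewrite adjmxM !mulmxA.
apply: pM; apply: contraNneq x0 => Px0.
by rewrite -[x](mulKmx uP) Px0 mulmx0.
Qed.

Lemma posdef_unit M : posdef M -> M \in unitmx.
Proof.
move=> pM; have [hM _] := pM; have [U UU ->] := sorted_diagonalization hM.
have [uU uU'] := mulmx1_unit UU.
rewrite !unitmx_mul uU uU' andbT /= unitmxE det_diag unitfE.
by apply/prodf_neq0 => i _; rewrite mxE gt_eqF ?posdef_eigvals_gt0.
Qed.

Lemma posdef_inv M : posdef M -> posdef (invmx M).
Proof.
move=> pM; have [hM _] := pM; have uM := posdef_unit pM.
have := posdef_congr (P := invmx M) _ pM; rewrite unitmx_inv => /(_ uM).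
by rewrite adjmx_inv hM mulVmx // mul1mx.
Qed.

Lemma sqrtmxP M : psd M -> psd (sqrtmx M) /\ sqrtmx M *m sqrtmx M = M.
Proof.
move=> pM; have [hM _] := pM; have [U UU ME] := sorted_diagonalization hM.
apply: (epsilon_spec (inhabits 0) (fun S : 'M[C]_n => psd S /\ S *m S = M)).
(* [r k] holds the roots of order [2 ^ k]: [r 1] gives the square root, and [r 2] exhibits it as a
   Gram matrix, hence positive semidefinite. *)
pose r k := diag_mx (\row_i iter k sqrtC (eigvals M)`_i) : 'M[C]_n.
have rr k : r k.+1 *m r k.+1 = r k.
  rewrite /r mulmx_diag; congr diag_mx.
  by apply/rowP => i; rewrite !mxE -expr2 sqrtCK.
have r2h : adjmx (r 2) = r 2.
  rewrite adjmx_diag; congr diag_mx; apply/rowP => i; rewrite !mxE.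
  by apply: CrealP; rewrite ger0_real //= !sqrtC_ge0 psd_eigvals_ge0.
exists (adjmx U *m r 1 *m U); split.
  have -> : adjmx U *m r 1 *m U = adjmx (r 2 *m U) *m (r 2 *m U).
    by rewrite adjmxM r2h -rr !mulmxA.
  exact: psd_gram.
rewrite !mulmxA -[_ *m U *m adjmx U]mulmxA UU mulmx1.
by rewrite -[_ *m r 1 *m r 1]mulmxA rr.
Qed.

Lemma posdef_sqrtmx_unit M : posdef M -> sqrtmx M \in unitmx.
Proof.
move=> pM; have [_ sM] := sqrtmxP (posdef_psd pM).
by have := posdef_unit pM; rewrite -{1}sM unitmx_mul => /andP[].
Qed.

(** For [K *m K = A] and [H] the inverse of [A^-1 # B], these [X] and [Y] are the two matrices of
    the theorem. *)
Lemma prod_eigvals_le H K (T := K *m K *m H *m invmx K)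
    (X := H *m (K *m K) *m H) (Y := T *m adjmx T) (k : nat) :
    hermitian H -> hermitian K -> H \in unitmx -> K \in unitmx -> (k <= n)%N ->
  \prod_(i < k) (eigvals X)`_i <= \prod_(i < k) (eigvals Y)`_i.
Proof.
move=> hH hK uH uK le_kn.
have XE : X = adjmx (K *m H) *m (K *m H) by rewrite adjmxM hH hK /X !mulmxA.
have pX : posdef X.
  rewrite XE -[adjmx _]mulmx1; apply: posdef_congr posdef1.
  by rewrite unitmx_mul uK.
have pY : psd Y by rewrite /Y -{1}[T]adjmxK; apply: psd_gram.
have [hX _] := pX; have [U UU XD] := sorted_diagonalization hX.
(* The columns of [V] are orthonormal eigenvectors of [X] for its [k] largest eigenvalues. *)
pose w := widen_ord le_kn; pose V := adjmx (rowsub w U).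
pose D := diag_mx (\row_(i < k) (eigvals X)`_i).
have VV : adjmx V *m V = 1%:M.
  rewrite /V adjmxK -colsub_adjmx -mxsub_mul UU.
  by apply/matrixP => i j; rewrite !mxE.
have XV : X *m V = V *m D.
  have : X *m adjmx U = adjmx U *m diag_mx (\row_i (eigvals X)`_i).
    by rewrite [in LHS]XD -mulmxA UU mulmx1.
  rewrite /V -colsub_adjmx mulmx_colsub => ->.
  by rewrite !mul_mx_diag; apply/matrixP => i j; rewrite !mxE.
(* Since [T *m S] equals [invmx H *m X *m H], multiplying by [invmx H] turns eigenvectors of [X]
   into eigenvectors of [T *m S]. *)
pose W := invmx H *m V; pose S := K *m H; pose g := \det (adjmx W *m W).
have TSW : T *m S *m W = W *m D.
  rewrite /W -(mulmxA (invmx H)) -XV /T /S /X !mulmxA mulmxKV // mulmxK //.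
  by rewrite mulVmx // mul1mx.
(* If [g] were 0, Cauchy-Schwarz for [H *m V] and [W], whose cross Gram matrix is the identity,
   would give [1 <= 0]. *)
have g_gt0 : 0 < g.
  rewrite lt_def det_gram_ge0 andbT; apply/eqP => g0.
  have := det_CauchySchwarz (H *m V) W.
  rewrite adjmxM hH /W !mulmxA mulmxK // VV det1 normr1 expr1n.
  by move: g0; rewrite /g /W !mulmxA => ->; rewrite mulr0 ler10.
set p := \prod_(i < k) _; set q := \prod_(i < k) _.
have p_gt0 : 0 < p.
  by apply: prodr_gt0 => i _; apply: (posdef_eigvals_gt0 pX (w i)).
have detD : \det D = p by rewrite det_diag; apply: eq_bigr => i _; rewrite mxE.
have := det_CauchySchwarz (adjmx T *m W) (S *m W).
have -> : adjmx (adjmx T *m W) *m (S *m W) = adjmx W *m W *m D.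
  by rewrite adjmxM adjmxK -[RHS]mulmxA -TSW !mulmxA.
have EY : adjmx (adjmx T *m W) *m (adjmx T *m W) = adjmx W *m Y *m W.
  by rewrite adjmxM adjmxK /Y !mulmxA.
have EX : adjmx (S *m W) *m (S *m W) = adjmx W *m X *m W.
  by rewrite XE adjmxM !mulmxA.
rewrite EY EX det_mulmx detD -/g ger0_norm; last by rewrite mulr_ge0 ?ltW.
(* The chain reads [(g * p) ^ 2 <= (q * g) * (p * g)]; it remains to cancel [g ^ 2] and [p]. *)
move=> /le_trans/(_ (ler_pM _ _ (det_compression_le W pY)
  (det_compression_le W (posdef_psd pX)))).
rewrite -{1}EY -{1}EX !det_gram_ge0 => /(_ isT isT).
rewrite -/p -/q -/g mulrACA exprMn mulrC ler_pM2r ?exprn_gt0 //.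
by rewrite ler_pM2r.
Qed.

End PositiveMatrices.

(** * Reduction of the theorem to the product inequality *)

Theorem theorem4p6 (C : numClosedFieldType) (n : nat) (A B : 'M[C]_n) :
  posdef A -> posdef B ->
  log_majorized (sp_hat_m1 A B) (A *m invmx B *m A).
Proof.
move=> pA pB; have uA := posdef_unit pA; have uB := posdef_unit pB.
have pAi := posdef_inv pA.
have [[hL _] LL] := sqrtmxP (posdef_psd pAi).
have uL := posdef_sqrtmx_unit pAi.
rewrite /sp_hat_m1 /gmean.
(* [K] inverts a square root of [invmx A], so it is a square root of [A]. *)
set L := sqrtmx (invmx A) in hL LL uL *; set K := invmx L.
have uK : K \in unitmx by rewrite unitmx_inv.
have hK : hermitian K by rewrite /hermitian adjmx_inv hL.
have KK : K *m K = A by rewrite -[A]invmxK -LL invmx_mul.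
have pN : posdef (K *m B *m K) by rewrite -{1}hK; apply: posdef_congr.
have [[hS _] SS] := sqrtmxP (posdef_psd pN).
have uS := posdef_sqrtmx_unit pN.
set S := sqrtmx (K *m B *m K) in hS SS uS *.
set G := L *m S *m L.
have hG : hermitian G by rewrite /hermitian !adjmxM hL hS mulmxA.
have uG : G \in unitmx by rewrite !unitmx_mul uL uS.
set H := invmx G.
have uH : H \in unitmx by rewrite unitmx_inv.
have hH : hermitian H by rewrite /hermitian adjmx_inv hG.
(* The geometric mean [G] of [invmx A] and [B] solves this Riccati equation. *)
have GAG : G *m A *m G = B.
  rewrite -KK /G !mulmxA mulmxK // mulmxKV // -[_ *m S *m S]mulmxA SS.
  by rewrite !mulmxA mulmxV // mul1mx mulmxKV.
have BE : invmx B = H *m invmx A *m H.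
  have uGA : G *m A \in unitmx by rewrite unitmx_mul uG.
  by rewrite -GAG (invmx_mul uGA uG) (invmx_mul uG uA) mulmxA.
have YE : A *m invmx B *m A =
    (K *m K *m H *m invmx K) *m adjmx (K *m K *m H *m invmx K).
  by rewrite !adjmxM adjmx_inv hK hH BE -LL /K invmxK -/K -KK !mulmxA.
(* Both determinants equal [\det A * \det H ^ 2]. *)
split=> [k /andP[_ kn]|]; last first.
  rewrite BE !det_mulmx (det_inv A).
  have a0 : \det A != 0 by rewrite -unitfE -unitmxE.
  by rewrite [_ / \det A * _]mulrAC [\det A * _]mulrC divfK // mulrAC.
have le_kn : (k <= n)%N by apply: leq_trans kn (leq_pred n).
(* [eigval] counts from 1 and [eigvals] from 0, hence the shift. *)
rewrite !big_add1 /= !big_mkord YE -{1}KK.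
exact: prod_eigvals_le.
Qed.
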